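(* Let $H$ be a collection of probability measures on a measurable space $\mathcal{X}$, let $Q$ be a probability measure on $\mathcal{X}$ with generalized Lebesgue decomposition $Q=Q_a+Q_s$ with respect to $H$, and let $U:[0,\infty]\to[-\infty,\infty]$ be measurable. Suppose that $U$ is concave and upper semicontinuous. Assume there exists some benchmark e-value $\varepsilon_0\in\mathcal{E}(H)$ such that $U(\varepsilon_0)$ is $Q_a$-almost surely finite and $$\mathrm{E}^{Q_a}[U(\varepsilon)-U(\varepsilon_0)]$$ is well-defined for every $\varepsilon\in\mathcal{E}(H)$. Define $$C(\varepsilon_0):=\left\{\varepsilon\in\mathcal{E}(H): \mathrm{E}^{Q_a}[U(\varepsilon)-U(\varepsilon_0)]\ge 0\right\}.$$ If $\left\{[U(\varepsilon)-U(\varepsilon_0)]^+ : \varepsilon\in C(\varepsilon_0)\right\}$ is uniformly integrable under $Q_a$, then a $U$-optimal e-value exists. If $U$ is finite on $(0,\infty)$, $\limsup_{z\to\infty}U(z)/z\le 0$ and $U(\varepsilon_0)$ is $Q_a$-integrable, then this uniform integrability follows from $\sup_{\varepsilon\in C(\varepsilon_0)}\mathrm{E}^{Q_a}[\varepsilon]<\infty$.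
   Context: Notation: $\mathrm{E}^\mu[f]=\int f\,d\mu$ for any nonnegative measure $\mu$; $[\cdot]^+$ is the positive part. Concavity and upper semicontinuity of $U$ are understood on $[0,\infty)$ (valid e-values are finite $Q_a$-a.s., so $U(\infty)$ is immaterial). An event is $H$-negligible if it has probability zero under every $P\in H$. The generalized Lebesgue decomposition of $Q$ with respect to $H$ is $Q=Q_a+Q_s$, where the nonnegative measure $Q_s$ is concentrated on an $H$-negligible event and the nonnegative measure $Q_a$ assigns zero mass to every $H$-negligible event. The class of valid e-values for $H$ is $\mathcal{E}(H)=\{\varepsilon:\mathcal{X}\to[0,\infty]\ \text{measurable}: \mathrm{E}^P[\varepsilon]\le 1\ \text{for all } P\in H\}$. A valid e-value $\varepsilon^*\in\mathcal{E}(H)$ is $U$-optimal (against $Q_a$) if, for every $\varepsilon\in\mathcal{E}(H)$, $\mathrm{E}^{Q_a}[U(\varepsilon^* )-U(\varepsilon)]$ is well-defined and $\ge 0$. Throughout, ''well-defined'' for such an expectation means that the integrand avoids an ambiguous $\infty-\infty$ $Q_a$-almost surely, and that its positive part or its negative part has finite $Q_a$-expectation. *)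

(* Defs.v *)
From HB Require Import structures.
From mathcomp Require Import all_boot all_order all_algebra.
From mathcomp Require Import all_classical all_reals all_analysis.
From mathcomp Require Import measurable_realfun.

Set Implicit Arguments.
Unset Strict Implicit.
Unset Printing Implicit Defensive.

Import Order.TTheory GRing.Theory Num.Theory.
Import numFieldNormedType.Exports.

Local Open Scope classical_set_scope.
Local Open Scope ring_scope.
Local Open Scope ereal_scope.

Section evalues.
Context {d : measure_display} {T : measurableType d} {R : realType}.

Definition negligible_for (H : set (probability T R)) (A : set T) : Prop :=
  measurable A /\ forall P : probability T R, H P -> P A = 0.

Definition generalized_lebesgue_decomposition (H : set (probability T R))
    (Q : probability T R) (Qa Qs : {measure set T -> \bar R}) : Prop :=
  [/\ forall A, measurable A -> Q A = Qa A + Qs A,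
      exists2 N, negligible_for H N & Qs (~` N) = 0
    & forall A, negligible_for H A -> Qa A = 0].

Definition evalues (H : set (probability T R)) : set (T -> \bar R) :=
  [set e : T -> \bar R | [/\ measurable_fun setT e, forall x, 0 <= e x
    & forall P : probability T R, H P -> \int[P]_x e x <= 1]].

(* [f x +? - g x] says that [f x - g x] is not an ambiguous oo - oo (which the
   library evaluates to -oo). *)
Definition expectation_diff_wd (mu : {measure set T -> \bar R})
    (f g : T -> \bar R) : Prop :=
  {ae mu, forall x, f x +? - g x} /\
  (\int[mu]_x (f \- g)^\+ x < +oo \/ \int[mu]_x (f \- g)^\- x < +oo).

Definition U_optimal (H : set (probability T R))
    (Qa : {measure set T -> \bar R}) (U : \bar R -> \bar R)
    (e' : T -> \bar R) : Prop :=
  evalues H e' /\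
  forall e : T -> \bar R, evalues H e ->
    expectation_diff_wd Qa (U \o e') (U \o e) /\
    0 <= \int[Qa]_x (U (e' x) - U (e x)).

Definition improving_evalues (H : set (probability T R))
    (Qa : {measure set T -> \bar R}) (U : \bar R -> \bar R)
    (e0 : T -> \bar R) : set (T -> \bar R) :=
  [set e : T -> \bar R | evalues H e /\ 0 <= \int[Qa]_x (U (e x) - U (e0 x))].

Definition uniformly_integrable (mu : {measure set T -> \bar R})
    (F : set (T -> \bar R)) : Prop :=
  forall eps : R, (0 < eps)%R -> exists M : R, forall f, F f ->
    \int[mu]_(x in [set x | M%:E <= `|f x|]) `|f x| <= eps%:E.

End evalues.

Section utility.
Context {R : realType}.

(* Since [+oo + -oo = -oo] here, the inequality is void whenever its left-hand
   side is ambiguous, so this is convexity of the hypograph of [U] over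
   [0, +oo[. *)
Definition concave_nonneg (U : \bar R -> \bar R) : Prop :=
  forall x y t : R, (0 <= x)%R -> (0 <= y)%R -> (0 <= t <= 1)%R ->
    t%:E * U x%:E + (1 - t)%:E * U y%:E <= U (t * x + (1 - t) * y)%:E.

(* The subspace topology makes the points outside [0, +oo[ isolated, hence
   the values of [U] there are unconstrained. *)
Definition usc_nonneg (U : \bar R -> \bar R) : Prop :=
  lower_semicontinuous
    (fun z : subspace (`[0%R, +oo[ : set R) => - U (z : R)%:E).

End utility.

(* Main.v *)
Require Import Defs.
From HB Require Import structures.
From mathcomp Require Import all_boot all_order all_algebra.
From mathcomp Require Import all_classical all_reals all_analysis.
From mathcomp Require Import measurable_realfun.
From mathcomp Require Import lra ring.

(** Existence of the optimal e-value is a direct method argument: maximize the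
    expected utility gain [V e = \int (U (e x) - U (e0 x))] over all e-values and
    pass to the limit along a maximizing sequence.

    Compactness comes from convexity. The near-maximizers of [V] form a
    decreasing sequence of midpoint convex sets, because [U] is concave and the
    e-values are a convex class. Choosing in each of these sets a near-minimizer
    of the strictly convex functional [f |-> \int expR (- f)] forces the choices
    to converge almost everywhere under [Qa], possibly to [+oo]
    ([midpoint_convex_cvg_selection]). The lower limit of the sequence is again
    an e-value by Fatou's lemma under each measure of the hypothesis; it is
    therefore finite [Qa]-almost everywhere, since [Qa] does not charge
    negligible events.

    Upper semicontinuity of [U] bounds the upper limit of the utilities by the
    utility of the limit, and uniform integrability of the positive parts of the
    gains yields a reverse Fatou lemma
    ([uniformly_integrable_limsup_integral]); together they show that the limit
    attains the supremum of [V] ([utility_gain_maximizer]). A maximizer of [V]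
    has an integrable gain, and comparing it with an arbitrary e-value is then a
    matter of additivity ([utility_gain_maximizer_optimal]).

    For the criterion, concavity and sublinear growth give for every
    [delta > 0] an affine bound [U z <= K + delta * z]. The positive gains are
    thus dominated by [delta * e] plus one integrable function, and a bound on
    the means of the e-values makes the first term uniformly small
    ([uniformly_integrable_of_bounded_mean]). *)

Set Implicit Arguments.
Unset Strict Implicit.
Unset Printing Implicit Defensive.

Import Order.TTheory GRing.Theory Num.Theory.
Import numFieldNormedType.Exports.

Local Open Scope classical_set_scope.
Local Open Scope ring_scope.
Local Open Scope ereal_scope.

(** * Comparison and integrability of extended real functions *)

Section integral_facts.
Context {d : measure_display} {T : measurableType d} {R : realType}.
Variable mu : {measure set T -> \bar R}.
Implicit Types f g h : T -> \bar R.

(** With [oo - oo = -oo], subtraction of extended reals is monotone even at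
    ambiguous values, so it suffices to compare the positive parts and the
    negative parts separately. *)
Lemma ae_le_integral f h : measurable_fun setT f -> measurable_fun setT h ->
  {ae mu, forall x, f x <= h x} -> \int[mu]_x f x <= \int[mu]_x h x.
Proof.
move=> mf mh fh; rewrite integralE [leRHS]integralE leeB//.
- apply: ae_ge0_le_integral => //; try exact: measurable_funepos.
  apply: filterS fh => x fh _; rewrite !funeposE.
  by rewrite ge_max !le_max fh lexx orbT.
- apply: ae_ge0_le_integral => //; try exact: measurable_funeneg.
  apply: filterS fh => x fh _; rewrite !funenegE.
  by rewrite ge_max !le_max leeN2 fh lexx orbT.
Qed.

Lemma integrable_funepos_funeneg f : measurable_fun setT f ->
  \int[mu]_x f^\+ x < +oo -> \int[mu]_x f^\- x < +oo ->
  mu.-integrable setT f.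
Proof.
move=> mf fp fn; apply/integrableP; split => //.
have -> : (fun x => `|f x|) = (fun x => f^\+ x + f^\- x).
  by rewrite [LHS]fune_abse.
rewrite ge0_integralD//; first exact: lte_add_pinfty.
- exact: measurable_funepos.
- exact: measurable_funeneg.
Qed.

Lemma integrable_of_integral_gtNy f : measurable_fun setT f ->
  \int[mu]_x f^\+ x < +oo -> -oo < \int[mu]_x f x -> mu.-integrable setT f.
Proof.
move=> mf fp; rewrite integralE => fi; apply: integrable_funepos_funeneg => //.
by rewrite ltey; apply/eqP => E; move: fi; rewrite E addeC addNye ltxx.
Qed.

Lemma integrable_cst_lty (r : R) : mu setT < +oo ->
  mu.-integrable setT (fun=> r%:E).
Proof.
move=> muT; apply/integrableP; split => //.
by rewrite (integral_cst mu measurableT `|r%:E|) lte_mul_pinfty.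
Qed.

Lemma integral_restrict_anti f (M M' : R) : measurable_fun setT f ->
  (M <= M')%R ->
  \int[mu]_(x in [set x | M'%:E <= `|f x|]) `|f x| <=
  \int[mu]_(x in [set x | M%:E <= `|f x|]) `|f x|.
Proof.
move=> mf MM'.
have mS (r : R) : measurable [set x | r%:E <= `|f x|].
  rewrite -[X in measurable X]setTI.
  exact/(emeasurable_fun_c_infty measurableT)/measurableT_comp.
apply: ge0_subset_integral => //.
  by apply: measurable_funTS; exact: measurableT_comp.
by move=> x /=; apply: le_trans; rewrite lee_fin.
Qed.

End integral_facts.

(** * Uniform integrability and lower limits *)

Section uniform_integrability.
Context {d : measure_display} {T : measurableType d} {R : realType}.
Variable mu : {measure set T -> \bar R}.
Implicit Types f g h : T -> \bar R.

Lemma uniformly_integrable_subset (F G : set (T -> \bar R)) : F `<=` G ->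
  uniformly_integrable mu G -> uniformly_integrable mu F.
Proof.
by move=> FG uiG e /uiG[M GM]; exists M => f /FG; exact: GM.
Qed.

Lemma measurable_ge_abse f (M : R) : measurable_fun setT f ->
  measurable [set x | M%:E <= `|f x|].
Proof.
move=> mf; rewrite -[X in measurable X]setTI.
exact/(emeasurable_fun_c_infty measurableT)/measurableT_comp.
Qed.

Lemma measurable_tail f (M : R) : measurable_fun setT f ->
  measurable_fun setT ((abse \o f) \_ [set x | M%:E <= `|f x|]).
Proof.
move=> mf; apply/measurable_restrict => //; first exact: measurable_ge_abse.
by apply: measurable_funTS; exact: measurableT_comp.
Qed.

Lemma integral_tailE f (M : R) :
  \int[mu]_(x in [set x | M%:E <= `|f x|]) `|f x| =
  \int[mu]_x ((abse \o f) \_ [set x | M%:E <= `|f x|]) x.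
Proof. by rewrite integral_mkcond. Qed.

Lemma uniformly_integrable_bounded (F : set (T -> \bar R)) :
  mu setT < +oo -> uniformly_integrable mu F ->
  exists B : R, forall f, F f -> measurable_fun setT f ->
    \int[mu]_x `|f x| <= B%:E.
Proof.
move=> muT /(_ 1%R ltr01)[M FM]; exists (1 + `|M| * fine (mu setT))%R => f.
move=> /FM; rewrite integral_tailE => fM mf.
have mt := measurable_tail M mf.
apply: (@le_trans _ _ (\int[mu]_x
    (((abse \o f) \_ [set x | M%:E <= `|f x|]) x + `|M%:E|))).
  apply: ge0_le_integral => //; first exact: measurableT_comp.
    by apply: emeasurable_funD.
  move=> x _; rewrite /patch; case: ifPn => /=; first by rewrite leeDl.
  rewrite notin_setE/= add0e => /negP; rewrite -ltNge => /ltW/le_trans; apply.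
  by rewrite lee_fin ler_norm.
rewrite ge0_integralD//; last 1 first.
- by move=> x _; rewrite /patch; case: ifP => /=.
rewrite (integral_cst mu measurableT `|M%:E|) EFinD EFinM fineK ?leeD2r//.
by rewrite ge0_fin_numE.
Qed.

(** Dominated convergence, applied to the truncations of [Y] above [n]. *)
Lemma integrable_uniformly_integrable1 (Y : T -> \bar R) :
  mu.-integrable setT Y -> uniformly_integrable mu [set Y].
Proof.
move=> iY e e0; have /integrableP[mY _] := iY.
pose t (n : nat) := (abse \o Y) \_ [set x | (n%:R)%:E <= `|Y x|].
have ct : {ae mu, forall x, setT x -> t n x @[n --> \oo] --> 0}.
  have := integrable_ae measurableT iY; apply: filterS => x /(_ I) Yx _.
  apply: cvg_near_cst; near=> n; rewrite /t /patch ifF//.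
  apply/negbTE; rewrite notin_setE/=; apply/negP; rewrite -ltNge.
  rewrite -(@fineK _ `|Y x|) ?abse_fin_num// lte_fin.
  by near: n; exact: nbhs_infty_gtr.
have dt : {ae mu, forall x, forall n, setT x -> `|t n x| <= (abse \o Y) x}.
  apply: aeW => x n _ /=; rewrite /t /patch.
  by case: ifP => _; [rewrite abse_id|rewrite abse0 abse_ge0].
have [_ _] := dominated_convergence measurableT
  (fun n => measurable_tail n%:R mY) (measurable_cst 0) ct
  (integrable_abse iY) dt.
rewrite integral_cst// mul0e => /fine_cvgP[fn].
move=> /cvgr0Pnorm_le/(_ e e0) tn.
have [n [tfin tle]] : exists n, \int[mu]_x t n x \is a fin_num /\
    (`|fine (\int[mu]_x t n x)| <= e)%R.
  near \oo => n; exists n; split; near: n => //.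
exists n%:R => _ ->; rewrite integral_tailE -(fineK tfin) lee_fin.
exact: le_trans (ler_norm _) tle.
Unshelve. all: by end_near. Qed.

Lemma lte_exists_fin (x y : \bar R) : x < y -> exists a : R, x < a%:E < y.
Proof.
case: x y => [r| |] [s| |]//=; rewrite ?ltxx// => rs.
- exists ((r + s) / 2)%R; rewrite !lte_fin in rs *.
  by rewrite midf_lt//= midf_lt.
- by exists (r + 1)%R; rewrite ltry lte_fin ltrDl ltr01.
- by exists (s - 1)%R; rewrite ltNyr lte_fin ltrBlDr ltrDl ltr01.
- by exists 0%R; rewrite ltNyr ltry.
Qed.

Lemma lee_limn_einf (u : nat -> \bar R) (l : \bar R) :
  (forall a : R, a%:E < l -> \forall k \near \oo, a%:E <= u k) ->
  l <= limn_einf u.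
Proof.
move=> ul; rewrite leNgt; apply/negP => /lte_exists_fin[a /andP[la al]].
have [N _ Nu] := ul _ al; move: la; apply/negP; rewrite -leNgt.
rewrite limn_einf_lim (cvg_lim _ (@cvg_einfs_sup _ u))//.
apply: (@le_trans _ _ (einfs u N)); last first.
  by apply: ereal_sup_ubound; exists N.
by apply: le_ereal_inf_tmp => _ [k /= Nk <-]; exact: Nu.
Qed.

Lemma limn_einf_le (u : nat -> \bar R) (l : \bar R) :
  (\forall k \near \oo, u k <= l) -> limn_einf u <= l.
Proof.
case=> N _ Nu; rewrite limn_einf_lim (cvg_lim _ (@cvg_einfs_sup _ u))//.
apply: ge_ereal_sup => _ [n _ <-].
apply: (@le_trans _ _ (u (maxn N n))); last by apply: Nu => /=; exact: leq_maxl.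
by apply: ereal_inf_lbound; exists (maxn N n) => //=; exact: leq_maxr.
Qed.

Lemma measurable_limn_einf (f_ : nat -> T -> \bar R) :
  (forall k, measurable_fun setT (f_ k)) ->
  measurable_fun setT (fun x => limn_einf (f_^~ x)).
Proof.
move=> mf; rewrite /limn_einf; apply: measurableT_comp => //.
by apply: measurable_fun_limn_esup => k; exact: measurableT_comp.
Qed.

End uniform_integrability.

(** * A reverse Fatou lemma *)

Section reverse_fatou.
Context {d : measure_display} {T : measurableType d} {R : realType}.
Variable mu : {measure set T -> \bar R}.
Hypothesis muT : mu setT < +oo.

(** The shortfall below the level [M]: [M%:E - deficit M y] is [y] cut off at
    [M]. Being nonnegative, it is amenable to Fatou's lemma, and it turns lower
    bounds on integrals into upper bounds. *)
Definition deficit (M : R) (y : \bar R) : \bar R := M%:E - mine y M%:E.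

Lemma deficit_ge0 M y : 0 <= deficit M y.
Proof. by rewrite /deficit sube_ge0 ?orbT// ge_min lexx orbT. Qed.

Lemma deficit_le M y : M%:E - deficit M y <= y.
Proof.
rewrite /deficit; case: y => [r| |]; rewrite ?leey//; last first.
  by rewrite minNye.
rewrite -EFin_min -!EFinB lee_fin opprB addrC subrK.
by rewrite ge_min lexx.
Qed.

(** Here [t] bounds the part of [r] that lies above the level [M]. *)
Lemma deficit_fin_le (M r t : R) : (r - M <= t)%R -> (0 <= t)%R ->
  deficit M r%:E <= (M - r + t)%:E.
Proof.
move=> rMt t0; rewrite /deficit -EFin_min -!EFinB lee_fin.
by case: (leP r M) => rM; lra.
Qed.

Lemma measurable_deficit M (f : T -> \bar R) : measurable_fun setT f ->
  measurable_fun setT (deficit M \o f).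
Proof.
by move=> mf; apply: emeasurable_funB => //; apply: measurable_mine.
Qed.

(** [deficit M] is continuous and nonincreasing, so it turns a bound on the
    upper limit of [u] into one on a lower limit; the upper limit is written
    with neighbourhoods to match upper semicontinuity. *)
Lemma deficit_liminf (M : R) (u : nat -> \bar R) (l : \bar R) :
  (forall a : R, l < a%:E -> \forall k \near \oo, u k < a%:E) ->
  deficit M l <= limn_einf (deficit M \o u).
Proof.
move=> ul; apply: lee_limn_einf => b bl.
have [b0|b0] := leP b 0%R.
  by apply: nearW => k; apply: (le_trans _ (deficit_ge0 _ _)); rewrite lee_fin.
have : l < (M - b)%:E.
  move: bl; rewrite /deficit; case: l {ul} => [r| |]; rewrite ?ltNyr ?ltNye//.
    rewrite -EFin_min -EFinB !lte_fin.
    by case: (leP r M) => rM; lra.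
  by rewrite minye -EFinB lte_fin subrr => /(lt_trans b0); rewrite ltxx.
move=> /ul; apply: filterS => k; rewrite /deficit /=.
case: (u k) => [r| |]//; last by rewrite minNye leey.
by rewrite -EFin_min -EFinB lte_fin lee_fin; case: (leP r M) => rM; lra.
Qed.

(** The deficit exceeds [M - f] only where [f] is above [M], by at most
    [f^\+], and uniform integrability bounds the mass there by [e]. *)
Lemma integral_deficit_le (M e : R) (f : T -> \bar R) : (0 <= M)%R ->
  mu.-integrable setT f ->
  \int[mu]_(x in [set x | M%:E <= `|f^\+ x|]) `|f^\+ x| <= e%:E ->
  \int[mu]_x deficit M (f x) <= M%:E * mu setT - \int[mu]_x f x + e%:E.
Proof.
move=> M0 fi fe; have /integrableP[mf _] := fi.
have mp := measurable_funepos mf.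
pose t := (abse \o f^\+) \_ [set x | M%:E <= `|f^\+ x|].
have mt : measurable_fun setT t by exact: measurable_tail.
have t0 x : 0 <= t x by rewrite /t /patch; case: ifP => /=.
have ti : mu.-integrable setT t.
  apply/integrableP; split => //.
  under eq_integral do rewrite gee0_abs//.
  by rewrite -integral_tailE; exact: le_lt_trans fe (ltry _).
have ci := integrable_cst_lty M muT.
apply: (@le_trans _ _ (\int[mu]_x (M%:E - f x + t x))).
  apply: ae_le_integral.
  - exact: measurable_deficit.
  - by apply: emeasurable_funD => //; exact: emeasurable_funB.
  have := integrable_ae measurableT fi; apply: filterS => x /(_ I).
  move=> fx; have -> : t x =
      if M%:E <= maxe (f x) 0 then maxe (f x) 0 else 0.
    rewrite /t /patch /= !funeposE gee0_abs ?le_max ?lexx ?orbT//.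
    case: ifPn => [|]; first by rewrite inE/= funeposE gee0_abs
      ?le_max ?lexx ?orbT// => ->.
    by rewrite notin_setE/= funeposE gee0_abs
      ?le_max ?lexx ?orbT// => /negP/negbTE ->.
  move: fx => /fineK <-; move: (fine _) => r.
  rewrite -EFin_max lee_fin; case: (leP M) => rM; rewrite -!EFinB -EFinD.
    apply: deficit_fin_le; last by rewrite le_max lexx orbT.
    by rewrite le_max [(r - M <= r)%R]lerBlDr lerDl M0.
  apply: deficit_fin_le => //; rewrite subr_le0.
  by apply: ltW; apply: le_lt_trans rM; rewrite le_max lexx.
rewrite integralD//; last exact: integrableB.
rewrite integralB// (integral_cst mu measurableT M%:E) leeD2l//.
by rewrite -integral_tailE.
Qed.

(** A reverse Fatou lemma: Fatou's lemma for the nonnegative functions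
    [deficit M \o g_ k], where uniform integrability makes the mass of [g_ k]
    above the level [M] negligible. *)
Lemma uniformly_integrable_limsup_integral (g_ : nat -> T -> \bar R)
    (g : T -> \bar R) (s : R) :
  (forall k, measurable_fun setT (g_ k)) -> measurable_fun setT g ->
  uniformly_integrable mu [set (g_ k)^\+ | k in setT] ->
  (forall e : R, (0 < e)%R ->
    \forall k \near \oo, (s - e)%:E <= \int[mu]_x g_ k x) ->
  {ae mu, forall x, forall a : R, g x < a%:E ->
    \forall k \near \oo, g_ k x < a%:E} ->
  s%:E <= \int[mu]_x g x.
Proof.
move=> mg_ mg ui sg_ usc.
have gi_ : \forall k \near \oo, mu.-integrable setT (g_ k).
  have := sg_ _ ltr01; apply: filterS => k sk.
  apply: integrable_of_integral_gtNy => //; last exact: lt_le_trans (ltNyr _) sk.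
  have [B uiB] := uniformly_integrable_bounded muT ui.
  have := uiB _ (imageP _ (I : setT k)) (measurable_funepos (mg_ k)).
  by under eq_integral do rewrite gee0_abs//; move/le_lt_trans; apply; exact: ltry.
apply/lee_subgt0Pr => e e0; have e20 : (0 < e / 2)%R by rewrite divr_gt0.
have [M0 uiM0] := ui _ e20.
pose M := Num.max M0 0%R.
have M_ge0 : (0 <= M)%R by rewrite le_max lexx orbT.
have uiM k : \int[mu]_(x in [set x | M%:E <= `|(g_ k)^\+ x|]) `|(g_ k)^\+ x|
    <= (e / 2)%:E.
  apply: le_trans (uiM0 _ (imageP _ (I : setT k))).
  by apply: integral_restrict_anti; [exact: measurable_funepos|
    rewrite le_max lexx].
have mdef := measurable_deficit M mg.
have fT : mu setT \is a fin_num by rewrite ge0_fin_numE.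
set m := fine (mu setT).
have defle : \int[mu]_x deficit M (g x) <= (M * m - (s - e))%:E.
  apply: (@le_trans _ _ (\int[mu]_x limn_einf (fun k => deficit M (g_ k x)))).
    apply: ae_ge0_le_integral => //.
    - by move=> x _; exact: deficit_ge0.
    - move=> x _; apply: lee_limn_einf => a a0; apply: nearW => k.
      exact: le_trans (ltW a0) (deficit_ge0 _ _).
    - apply: measurable_limn_einf => k; exact: measurable_deficit.
    - by apply: filterS usc => x gx _; exact: deficit_liminf gx.
  apply: le_trans (fatou _ measurableT _ _) _.
  - by move=> k; exact: measurable_deficit.
  - by move=> k x _; exact: deficit_ge0.
  apply: limn_einf_le; near=> k.
  have gik : mu.-integrable setT (g_ k) by near: k.
  apply: le_trans (integral_deficit_le M_ge0 gik (uiM k)) _.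
  have : (s - e / 2)%:E <= \int[mu]_x g_ k x by near: k; exact: sg_.
  rewrite -(fineK (integrable_fin_num measurableT gik)) -(fineK fT).
  rewrite -EFinM -EFinB -EFinD !lee_fin -/m => H; lra.
have dint : mu.-integrable setT (deficit M \o g).
  apply/integrableP; split => //.
  under eq_integral do rewrite gee0_abs ?deficit_ge0//.
  exact: le_lt_trans defle (ltry _).
apply: (@le_trans _ _ (\int[mu]_x (M%:E - deficit M (g x)))); last first.
  apply: ae_le_integral => //; first exact: emeasurable_funB.
  by apply: aeW => x; exact: deficit_le.
have ci := integrable_cst_lty M muT.
rewrite integralB// (integral_cst mu measurableT M%:E) -(fineK fT).
move: defle; rewrite -(fineK (integrable_fin_num measurableT dint)).
rewrite -EFinM -!EFinB !lee_fin -/m; lra.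
Unshelve. all: by end_near. Qed.

End reverse_fatou.

(** * Almost everywhere convergence from summable increments *)

Section komlos.
Context {d : measure_display} {T : measurableType d} {R : realType}.
Variable mu : {measure set T -> \bar R}.

(** By monotone convergence the sum of the absolute increments is integrable,
    hence finite almost everywhere, and the telescoping series then converges
    absolutely. *)
Lemma ae_cvgn_summable_increments (u : nat -> T -> R) :
  (forall k, measurable_fun setT (u k)) ->
  \sum_(0 <= k <oo) \int[mu]_x `|u k.+1 x - u k x|%:E < +oo ->
  {ae mu, forall x, cvgn (u ^~ x)}.
Proof.
move=> mu_ su.
pose D k x := `|u k.+1 x - u k x|%:E.
have mD k : measurable_fun setT (D k).
  by apply/measurable_EFinP/measurableT_comp => //; exact: measurable_funB.
have D0 k x : 0 <= D k x by rewrite lee_fin.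
have iD : mu.-integrable setT (fun x => \sum_(0 <= k <oo) D k x).
  apply/integrableP; split.
    by apply: ge0_emeasurable_sum => //.
  under eq_integral do rewrite gee0_abs ?nneseries_ge0//.
  by rewrite integral_nneseries.
have := integrable_ae measurableT iD; apply: filterS => x /(_ I) Dx.
have /normed_cvg su_x : cvgn [normed series (telescope (u ^~ x))].
  apply: nondecreasing_is_cvgn.
    by apply: nondecreasing_series => *; exact: normr_ge0.
  exists (fine (\sum_(0 <= k <oo) D k x)) => _ [n _ <-].
  rewrite -lee_fin fineK// /series/= -sumEFin.
  exact: nneseries_lim_ge.
rewrite (_ : u ^~ x = fun n => u 0%N x + series (telescope (u ^~ x)) n)%R.
  by apply: is_cvgD => //; exact: is_cvg_cst.
by apply/funext => n; rewrite -eq_sum_telescope.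
Qed.

(** On a finite measure space, geometrically small squared increments have
    summable first moments, by the inequality [a <= p * a ^+ 2 + p^-1]. *)
Lemma ae_cvgn_L2_increments (u : nat -> T -> R) (c : R) : mu setT < +oo ->
  (forall k, measurable_fun setT (u k)) ->
  (forall k, \int[mu]_x ((u k.+1 x - u k x) ^+ 2)%:E <= (c * 4^-1 ^+ k)%:E) ->
  {ae mu, forall x, cvgn (u ^~ x)}.
Proof.
move=> muT mu_ u2; apply: ae_cvgn_summable_increments => //.
have fT : mu setT \is a fin_num by rewrite ge0_fin_numE.
set m := fine (mu setT).
have mB k : measurable_fun setT (fun x => u k.+1 x - u k x)%R.
  exact: measurable_funB.
apply: (@le_lt_trans _ _ (\sum_(0 <= k <oo) ((c + m) * 2^-1 ^+ k)%:E)).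
  apply: lee_nneseries => [k _ _|k _]; first exact: integral_ge0.
  apply: (@le_trans _ _ (\int[mu]_x (2 ^+ k * (u k.+1 x - u k x) ^+ 2 +
                                       2^-1 ^+ k)%:E)).
    apply: ge0_le_integral => //.
    - by apply/measurable_EFinP/measurableT_comp => //; exact: mB.
    - apply/measurable_EFinP/measurable_funD => //.
      by apply: measurable_funM => //; exact: measurable_funX.
    move=> x _; rewrite lee_fin.
    (* the weight [2 ^+ k] balances the decay [4^-1 ^+ k] of the squares *)
    set y := (u k.+1 x - u k x)%R.
    rewrite -[(y ^+ 2)%R]real_normK ?num_real//.
    set a := `|y|%R; rewrite exprVn.
    have : (0 < 2 ^+ k :> R)%R by rewrite exprn_gt0.
    move: (2 ^+ k)%R => p p0; rewrite -subr_ge0.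
    have -> : (p * a ^+ 2 + p^-1 - a = p^-1 * ((p * a - 1 / 2) ^+ 2 + 3 / 4))%R.
      by field; rewrite gt_eqF.
    by rewrite mulr_ge0 ?invr_ge0 ?(ltW p0)// addr_ge0// sqr_ge0.
  under eq_integral do rewrite EFinD EFinM.
  have mB2 : measurable_fun setT (fun x => ((u k.+1 x - u k x) ^+ 2)%:E).
    by apply/measurable_EFinP/measurable_funX.
  rewrite ge0_integralD//; last 2 first.
  - by move=> x _; rewrite -EFinM lee_fin mulr_ge0// sqr_ge0.
  - exact: measurable_funeM.
  rewrite ge0_integralZl_EFin//; last by move=> x _; rewrite lee_fin sqr_ge0.
  rewrite (integral_cst mu measurableT (2^-1 ^+ k)%:E) -(fineK fT) -/m.
  apply: le_trans (leeD2r _ (lee_wpmul2l _ (u2 k))) _; first by rewrite lee_fin.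
  rewrite -!EFinM -EFinD lee_fin.
  rewrite mulrCA -exprMn (_ : 2 * 4^-1 = 2^-1 :> R)%R; last by field.
  by rewrite mulrDl [(m * _)%R]mulrC.
pose a := geometric (c + m)%R 2^-1%R.
rewrite (_ : (fun n => _) = EFin \o series a); last first.
  by apply/funext => n /=; rewrite /series/= sumEFin.
rewrite EFin_lim ?ltry//; apply: is_cvg_geometric_series.
by rewrite gtr0_norm// invf_lt1// ltr1n.
Qed.

End komlos.

(** * Convergent selections from decreasing midpoint convex sets *)

Section selection.
Context {d : measure_display} {T : measurableType d} {R : realType}.
Variable mu : {measure set T -> \bar R}.
Hypothesis muT : mu setT < +oo.

(** [x |-> expR (- x / 2)] is a homeomorphism of [[0, +oo]] onto [[0, 1]]; a
    limit 0 of the exponentials corresponds to divergence to [+oo]. *)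
Lemma cvgn_of_cvgn_expR (v : nat -> R) :
  cvgn (fun k => expR (- v k / 2)) -> cvgn (fun k => (v k)%:E).
Proof.
set u := (fun k => _) => /cvg_ex[l /= ul].
have vE k : v k = (- (2 * ln (u k)))%R by rewrite /u expRK; field.
have : (0 <= l)%R.
  rewrite -(cvg_lim _ ul)//; apply: limr_ge; first by apply/cvg_ex; exists l.
  by apply: nearW => k; exact: expR_ge0.
rewrite le_eqVlt => /predU1P[l0|l0].
  apply/cvg_ex; exists +oo; apply/cvgeyPge => A.
  have : \forall k \near \oo, (u k < expR (- A / 2))%R.
    by apply: (cvgr_lt l ul); rewrite -l0 expR_gt0.
  apply: filterS => k; rewrite /u ltr_expR lee_fin => H; lra.
apply/cvg_ex; exists (- (2 * ln l))%:E; apply: cvg_EFin; first exact: nearW.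
rewrite [X in X @ _ --> _](_ : _ = fun k => - (2 * ln (u k)))%R; last first.
  by apply/funext => k /=; rewrite -vE.
apply: cvgN; apply: cvgMr; apply: cvg_comp ul _; exact: continuous_ln.
Qed.

(** A substitute for Komlos-type theorems on convex combinations. Pick [f_ k]
    in some [C n] with [n >= k], nearly minimizing the strictly convex
    functional [J f = \int expR (- f)]. The minimal values [a n] increase with
    [n] to a finite limit [b], and the midpoint of [f_ k] and [f_ k.+1] cannot
    do much better than [b], so the identity
    [(expR (- x / 2) - expR (- y / 2)) ^+ 2 =
     expR (- x) + expR (- y) - 2 * expR (- ((x + y) / 2))]
    forces the functions [expR (- f_ k / 2)] to have small increments in [L2]. *)
Lemma midpoint_convex_cvg_selection (C : nat -> set (T -> R)) :
  (forall n, C n !=set0) ->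
  (forall n m, (n <= m)%N -> C m `<=` C n) ->
  (forall n f, C n f -> measurable_fun setT f /\ forall x, (0 <= f x)%R) ->
  (forall n f g, C n f -> C n g -> C n (fun x => (f x + g x) / 2)%R) ->
  exists f_ : nat -> T -> R, (forall n, C n (f_ n)) /\
    {ae mu, forall x, cvgn (fun k => (f_ k x)%:E)}.
Proof.
move=> C0 Cdec Cmeas Cmid.
pose J (f : T -> R) := \int[mu]_x (expR (- f x))%:E.
pose a n := ereal_inf (J @` C n).
have mexp (f : T -> R) : measurable_fun setT f ->
    measurable_fun setT (fun x => (expR (- f x))%:E).
  move=> mf; apply/measurable_EFinP; apply: measurableT_comp => //.
  exact: measurable_funN.
have J0 f : 0 <= J f by apply: integral_ge0 => x _; rewrite lee_fin expR_ge0.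
have JT n f : C n f -> J f <= mu setT.
  move=> /Cmeas[mf f0]; rewrite -[leRHS]mul1e -(integral_cst mu measurableT 1).
  apply: ge0_le_integral => //; first exact: mexp.
  by move=> x _ /=; rewrite lee_fin -expR0 ler_expR oppr_le0.
have Jfin n f : C n f -> J f \is a fin_num.
  by move=> /JT Jf; rewrite ge0_fin_numE// (le_lt_trans Jf).
have aT n : a n <= mu setT.
  have [f Cf] := C0 n; apply: le_trans (JT _ _ Cf).
  by apply: ereal_inf_lbound; exists f.
have a0 n : 0 <= a n by apply: le_ereal_inf_tmp => y [f _ <-].
have afin n : a n \is a fin_num by rewrite ge0_fin_numE// (le_lt_trans (aT n)).
pose b := ereal_sup (range a).
have ab n : a n <= b by apply: ereal_sup_ubound; exists n.
have bfin : b \is a fin_num.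
  rewrite ge0_fin_numE; last exact: le_trans (a0 0%N) (ab 0%N).
  by apply: le_lt_trans muT; apply: ge_ereal_sup => _ [n _ <-].
pose e k : R := (4^-1 ^+ k)%R.
have e0 k : (0 < e k)%R by rewrite exprn_gt0// invr_gt0.
have adec n m : (n <= m)%N -> a n <= a m.
  move=> nm; apply: le_ereal_inf_tmp => _ [f Cf <-].
  by apply: ereal_inf_lbound; exists f => //; exact: Cdec Cf.
have : forall k, exists g : nat * (T -> R),
    [/\ (k <= g.1)%N, C g.1 g.2, b - (e k)%:E <= a g.1 & J g.2 <= b + (e k)%:E].
  move=> k; have [_ [n _ <-] bn] := ub_ereal_sup_adherent (e0 k) bfin.
  have [_ [f Cf <-] fn] := lb_ereal_inf_adherent (e0 k) (afin (maxn k n)).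
  exists (maxn k n, f); split => //=; first exact: leq_maxl.
    by apply: le_trans (ltW bn) _; exact/adec/leq_maxr.
  by apply: le_trans (ltW fn) _; rewrite leeD2r ?ab.
move=> /choice[g gP]; pose f_ k := (g k).2; exists f_; split.
  by move=> k; have [kn Cg _ _] := gP k; exact: Cdec kn _ Cg.
have mf_ k : measurable_fun setT (f_ k) by have [_ /Cmeas[]] := gP k.
pose u k x := expR (- f_ k x / 2).
have mu_ k : measurable_fun setT (u k).
  apply: measurableT_comp => //; apply: measurable_funM => //.
  exact: measurable_funN.
have : {ae mu, forall x, cvgn (u ^~ x)}.
  apply: (@ae_cvgn_L2_increments _ _ _ _ _ 4%R) => // k.
  have [_ Ck bk Jk] := gP k; have [_ Ck1 bk1 Jk1] := gP k.+1.
  rewrite -/(f_ k) in Ck Jk; rewrite -/(f_ k.+1) in Ck1 Jk1.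
  (* the indices [(g k).1] need not increase with [k]; the midpoint lies in the
     larger of the two sets *)
  pose n := minn (g k).1 (g k.+1).1.
  pose h x := ((f_ k.+1 x + f_ k x) / 2)%R.
  have Ch : C n h.
    by apply: Cmid; [exact: Cdec (geq_minr _ _) _ Ck1
                    |exact: Cdec (geq_minl _ _) _ Ck].
  have ek : (e k.+1 <= e k)%R.
    by rewrite /e exprS ler_piMl ?exprn_ge0 ?invr_ge0// invf_le1// ler1n.
  have bh : b - (e k)%:E <= J h.
    apply: (@le_trans _ _ (a n)); last by apply: ereal_inf_lbound; exists h.
    rewrite /n; case: (leqP (g k).1 (g k.+1).1) => _ //.
    by apply: le_trans bk1; rewrite leeD2l// leeN2 lee_fin.
  have mh : measurable_fun setT h by have [] := Cmeas _ _ Ch.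
  have E : \int[mu]_x ((u k.+1 x - u k x) ^+ 2)%:E + 2%:E * J h =
           J (f_ k.+1) + J (f_ k).
    rewrite -ge0_integralZl_EFin//; last exact: mexp.
    rewrite -!ge0_integralD//.
    + apply: eq_integral => x _; rewrite -EFinM -!EFinD; congr EFin.
      have -> : expR (- h x) = (u k.+1 x * u k x)%R.
        by rewrite /u -expRD; congr expR; rewrite /h; field.
      have sq (y : R) : expR (- y) = (expR (- y / 2) ^+ 2)%R.
        by rewrite -expRM_natl; congr expR; field.
      by rewrite 2!sq -/(u k.+1 x) -/(u k x); ring.
    + exact: mexp.
    + exact: mexp.
    + by move=> x _; rewrite lee_fin sqr_ge0.
    + by apply/measurable_EFinP/measurable_funX/measurable_funB.
    + by apply: measurable_funeM; exact: mexp.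
  move: Jk Jk1 bh E; rewrite -(fineK (Jfin _ _ Ch)) -(fineK (Jfin _ _ Ck)).
  rewrite -(fineK (Jfin _ _ Ck1)) -(fineK bfin) -EFinB -!EFinD -EFinM !lee_fin.
  case: (\int[mu]_x _) => [r| |]//.
  rewrite -EFinD lee_fin -/(e k) => Jk Jk1 bh [E]; lra.
by apply: filterS => x; exact: cvgn_of_cvgn_expR.
Qed.

End selection.

(** * Concave and upper semicontinuous utilities *)

Section utility_facts.
Context {R : realType}.
Variable U : \bar R -> \bar R.

Lemma usc_nonneg_near : usc_nonneg U -> forall x a : R, (0 <= x)%R ->
  U x%:E < a%:E -> \forall y \near x, (0 <= y)%R -> U y%:E < a%:E.
Proof.
move=> uscU x a x0 Ua.
have /uscU[V Vx VU] : (- a)%:E < - U x%:E by rewrite EFinN lteN2.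
have x0' : (`[0%R, +oo[%classic : set R) x by rewrite /= in_itv/= andbT.
have [W Wx VW] := (@nbhs_subspace_ex R _ V x x0').1 Vx.
apply: filterS Wx => y Wy y0; rewrite -lteN2 -EFinN; apply: VU.
suff [] : (V `&` `[0%R, +oo[%classic) y by [].
by rewrite VW; split => //; rewrite /= in_itv/= andbT.
Qed.

Lemma concave_nonneg_midpoint : concave_nonneg U -> forall x y : R,
  (0 <= x)%R -> (0 <= y)%R ->
  2^-1%:E * U x%:E + 2^-1%:E * U y%:E <= U ((x + y) / 2)%:E.
Proof.
move=> concU x y x0 y0.
have h : (0 <= (2^-1 : R) <= 1)%R by rewrite invr_ge0 ler0n invf_le1// ler1n.
have := concU x y _ x0 y0 h.
rewrite (_ : 1 - 2^-1 = 2^-1)%R; last by field.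
by rewrite -mulrDr mulrC.
Qed.

(** Far out, sublinear growth bounds [U z] by [delta * z]. On the remaining
    interval [[0, a]], concavity bounds [U] in terms of its finite values at
    [a] and [2 * a]. *)
Lemma concave_nonneg_affine_bound : concave_nonneg U ->
  (forall z : R, (0 < z)%R -> U z%:E \is a fin_num) ->
  limf_esup (fun z : R => U z%:E * (z^-1)%:E) +oo%R <= 0 ->
  forall delta : R, (0 < delta)%R ->
  exists2 K : R, (0 <= K)%R &
    forall z : R, (0 <= z)%R -> U z%:E <= (K + delta * z)%:E.
Proof.
move=> concU Ufin lims delta delta0.
have : limf_esup (fun z : R => U z%:E * (z^-1)%:E) +oo%R < delta%:E.
  by apply: le_lt_trans lims _; rewrite lte_fin.
rewrite /limf_esup => /ereal_inf_lt[_ [A [A0 [Areal AB]] <-] AU].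
pose a := Num.max (A0 + 1)%R 1%R.
have a1 : (1 <= a)%R by rewrite le_max lexx orbT.
have a0 : (0 < a)%R by exact: lt_le_trans a1.
have Ua z : (a <= z)%R -> U z%:E <= (delta * z)%:E.
  move=> az; have z0 : (0 < z)%R by exact: lt_le_trans az.
  have Az : A z.
    by apply: AB; apply: lt_le_trans az; rewrite lt_max ltrDl ltr01.
  have : U z%:E * (z^-1)%:E < delta%:E.
    by apply: le_lt_trans AU; apply: ereal_sup_ubound; exists z.
  by rewrite lte_pdivrMr// => /ltW.
have Ua_fin := Ufin a a0.
have Ub_fin : U (2 * a)%:E \is a fin_num by apply: Ufin; rewrite mulr_gt0.
pose K := (2 * (`|fine (U a%:E)| + `|fine (U (2 * a)%:E)|))%R.
have K0 : (0 <= K)%R by rewrite mulr_ge0// addr_ge0.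
exists K => // z z0; have [az|za] := leP a z.
  by apply: le_trans (Ua z az) _; rewrite lee_fin lerDr.
(* [a] is a convex combination of [z] and [2 * a] with weight at least 1/2
   on [z] *)
pose t := (a / (2 * a - z))%R.
have bz : (0 < 2 * a - z)%R by lra.
have t1 : (2^-1 <= t <= 1)%R.
  by rewrite /t ler_pdivlMr// ler_pdivrMr//; apply/andP; split; lra.
have t01 : (0 <= t <= 1)%R by lra.
have a20 : (0 <= 2 * a)%R by lra.
have := concU z (2 * a)%R t z0 a20 t01.
rewrite (_ : t * z + (1 - t) * (2 * a) = a)%R; last by rewrite /t; field; rewrite gt_eqF.
move=> conc; apply: (@le_trans _ _ K%:E); last by rewrite lee_fin lerDl mulr_ge0// ltW.
move: conc; rewrite -(fineK Ua_fin) -(fineK Ub_fin).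
case: (U z%:E) => [r| |]; rewrite ?leNye//; last first.
  rewrite mulry gtr0_sg ?mul1e; last by lra.
  by rewrite -EFinM addye// leye_eq.
rewrite -!EFinM -EFinD !lee_fin /K.
set p := fine (U a%:E); set q := fine (U (2 * a)%:E) => trq.
have [r0|r0] := leP r 0%R.
  by apply: le_trans r0 _; rewrite mulr_ge0// addr_ge0.
have pp : (p <= `|p|)%R by exact: ler_norm.
have qq : (- q <= `|q|)%R by rewrite -normrN ler_norm.
have q0 : (0 <= `|q|)%R by [].
nra.
Qed.

End utility_facts.

(** * E-values *)

Section evalue_facts.
Context {d : measure_display} {T : measurableType d} {R : realType}.
Variable H : set (probability T R).
Implicit Types (e : T -> \bar R) (f g : T -> R).

(** The event where [e] is infinite is null under every measure of [H], because
    [e] has finite mean there; hence it is [Qa]-null. *)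
Lemma evalue_ae_fin_num (Qa : {measure set T -> \bar R}) e :
  (forall A, negligible_for H A -> Qa A = 0) -> evalues H e ->
  {ae Qa, forall x, e x \is a fin_num}.
Proof.
move=> Qa0 [me e0 eP].
pose N := [set x | e x = +oo].
have mN : measurable N.
  by rewrite -[N]setTI; exact: measurable_eqe me (measurable_cst _).
exists N; split => //.
  apply: Qa0; split => // P HP.
  have ie : P.-integrable setT e.
    apply/integrableP; split => //.
    under eq_integral do rewrite gee0_abs//.
    exact: le_lt_trans (eP P HP) (ltry _).
  have [B [mB PB NB]] := integrable_ae measurableT ie.
  apply/eqP; rewrite -measure_le0 -PB le_measure ?inE// => x Nx.
  by apply: NB => /(_ I); rewrite Nx.
move=> x /=; have := e0 x; rewrite /N/=; case: (e x) => //.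
Qed.

Lemma fine_evalue e : evalues H e -> evalues H (fun x => (fine (e x))%:E).
Proof.
move=> [me e0 eP]; split.
- by apply/measurable_EFinP; exact: measurableT_comp.
- by move=> x; rewrite lee_fin fine_ge0.
move=> P HP; apply: le_trans (eP P HP).
apply: ge0_le_integral => //.
- by move=> x _; rewrite lee_fin fine_ge0.
- by apply/measurable_EFinP; exact: measurableT_comp.
by move=> x _; have := e0 x; case: (e x).
Qed.

Lemma midpoint_evalue f g :
  evalues H (fun x => (f x)%:E) -> evalues H (fun x => (g x)%:E) ->
  evalues H (fun x => ((f x + g x) / 2)%:E).
Proof.
move=> [mf f0 fP] [mg g0 gP].
have h0 : (0 <= 2^-1 :> R)%R by rewrite invr_ge0.
have E x : ((f x + g x) / 2)%:E = (2^-1)%:E * ((f x)%:E + (g x)%:E).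
  by rewrite mulrC EFinM EFinD.
have mfg : measurable_fun setT (fun x => (f x)%:E + (g x)%:E).
  exact: emeasurable_funD.
have fg0 x : 0 <= (f x)%:E + (g x)%:E by exact: adde_ge0.
split.
- by under eq_fun do rewrite E; exact: measurable_funeM.
- by move=> x; rewrite E mule_ge0.
move=> P HP; under eq_integral do rewrite E.
rewrite ge0_integralZl_EFin// ge0_integralD//.
rewrite lee_pdivrMl// mule1.
by rewrite [leRHS](_ : _ = 1 + 1)%E ?leeD ?fP ?gP// -EFinD.
Qed.

Lemma limn_einf_evalue (e_ : nat -> T -> \bar R) :
  (forall k, evalues H (e_ k)) -> evalues H (fun x => limn_einf (e_ ^~ x)).
Proof.
move=> He; have me k : measurable_fun setT (e_ k) by have [] := He k.
have e0 k x : 0 <= e_ k x by have [] := He k.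
split.
- exact: measurable_limn_einf.
- move=> x; apply: lee_limn_einf => a a0; apply: nearW => k.
  exact: le_trans (ltW a0) (e0 _ _).
move=> P HP; apply: le_trans (fatou P measurableT me _) _ => //.
by apply: limn_einf_le; apply: nearW => k; have [_ _] := He k; exact.
Qed.

Lemma measurable_utility (U : \bar R -> \bar R) e :
  measurable_fun [set z : \bar R | 0 <= z] U -> evalues H e ->
  measurable_fun setT (U \o e).
Proof.
move=> mU [me e0 _].
have m0 : measurable [set z : \bar R | 0 <= z].
  rewrite -[X in measurable X]setTI.
  exact: (@emeasurable_fun_c_infty _ _ R setT id measurableT (@measurable_id _ _ _)).
apply: (measurable_comp m0 _ mU me) => _ [x _ <-]; exact: e0.
Qed.

End evalue_facts.

(** * Maximizing the expected utility gain *)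

Section optimal_evalue.
Context {d : measure_display} {T : measurableType d} {R : realType}.
Variables (H : set (probability T R)) (Qa : {measure set T -> \bar R}).
Hypothesis QaT : Qa setT < +oo.
Hypothesis Qa0 : forall A, negligible_for H A -> Qa A = 0.
Variable U : \bar R -> \bar R.
Hypothesis mU : measurable_fun [set z : \bar R | 0 <= z] U.
Variable e0 : T -> \bar R.
Hypothesis he0 : evalues H e0.
Hypothesis fin0 : {ae Qa, forall x, U (e0 x) \is a fin_num}.

Definition utility_gain (e : T -> \bar R) (x : T) : \bar R :=
  U (e x) - U (e0 x).

Local Notation gain := utility_gain.

Lemma measurable_utility_gain e : evalues H e ->
  measurable_fun setT (gain e).
Proof.
move=> He; apply: emeasurable_funB; first exact: (measurable_utility mU He).
exact: (measurable_utility mU he0).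
Qed.

(** Replacing an e-value by its real-valued version preserves both validity and
    expected utility; this lets the selection argument work with real functions. *)
Lemma integral_utility_gain_fine e : evalues H e ->
  \int[Qa]_x gain (fun x => (fine (e x))%:E) x = \int[Qa]_x gain e x.
Proof.
move=> He; apply: ae_eq_integral => //.
- exact/measurable_utility_gain/fine_evalue.
- exact: measurable_utility_gain.
have := evalue_ae_fin_num Qa0 He; apply: filterS => x ex _.
by rewrite /gain fineK.
Qed.

Lemma integral_utility_gain_benchmark : \int[Qa]_x gain e0 x = 0.
Proof.
rewrite (@ae_eq_integral _ _ _ Qa setT (cst 0))//.
- by rewrite integral0.
- exact: measurable_utility_gain.
by apply: filterS fin0 => x Ux _; rewrite /gain subee.
Qed.

Section uniformly_integrable_gains.
Hypothesis ui : uniformly_integrable Qa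
  [set (gain e)^\+ | e in improving_evalues H Qa U e0].

Lemma integral_utility_gain_bounded : exists B : R,
  forall e, improving_evalues H Qa U e0 e ->
  \int[Qa]_x (gain e)^\+ x <= B%:E.
Proof.
have [B uiB] := uniformly_integrable_bounded QaT ui.
exists B => e Ce; have [He _] := Ce.
have := uiB _ (imageP _ Ce) (measurable_funepos (measurable_utility_gain He)).
by under eq_integral do rewrite gee0_abs//.
Qed.

Lemma integrable_utility_gain e : improving_evalues H Qa U e0 e ->
  Qa.-integrable setT (gain e).
Proof.
move=> Ce; have [He Ve] := Ce; apply: integrable_of_integral_gtNy.
- exact: measurable_utility_gain.
- have [B /(_ _ Ce)] := integral_utility_gain_bounded.
  by move=> /le_lt_trans; apply; exact: ltry.
- exact: lt_le_trans Ve.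
Qed.

Lemma utility_ae_fin_num e : improving_evalues H Qa U e0 e ->
  {ae Qa, forall x, U (e x) \is a fin_num}.
Proof.
move=> /integrable_utility_gain/(integrable_ae measurableT).
apply: filterS2 fin0 => x U0 /(_ I); rewrite /gain.
by move: U0 => /fineK <-; case: (U (e x)).
Qed.

(** Superlevel sets of the expected utility gain are midpoint convex; integrability
    of the gains of improving e-values excludes infinite utilities. *)
Lemma integral_utility_gain_midpoint (f g : T -> R) (c : R) :
  concave_nonneg U ->
  improving_evalues H Qa U e0 (fun x => (f x)%:E) ->
  improving_evalues H Qa U e0 (fun x => (g x)%:E) ->
  c%:E <= \int[Qa]_x gain (fun x => (f x)%:E) x ->
  c%:E <= \int[Qa]_x gain (fun x => (g x)%:E) x ->
  c%:E <= \int[Qa]_x gain (fun x => ((f x + g x) / 2)%:E) x.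
Proof.
move=> concU Cf Cg; have [Hf _] := Cf; have [Hg _] := Cg.
have intf := integrable_utility_gain Cf.
have intg := integrable_utility_gain Cg.
set F := gain _ in intf *; set G := gain (fun x => (g x)%:E) in intg *.
move=> cF cG.
have intf2 := integrableZl measurableT 2^-1 intf.
have intg2 := integrableZl measurableT 2^-1 intg.
have Hh := midpoint_evalue Hf Hg.
apply: (@le_trans _ _ (\int[Qa]_x (2^-1%:E * F x + 2^-1%:E * G x))).
  rewrite integralD// !integralZl//.
  have -> : c%:E = 2^-1%:E * c%:E + 2^-1%:E * c%:E.
    by rewrite -EFinM -EFinD; congr EFin; field.
  by apply: leeD; rewrite lee_pmul2l// lte_fin.
apply: ae_le_integral.
- apply: emeasurable_funD; apply: measurable_funeM;
    exact: measurable_utility_gain.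
- exact: measurable_utility_gain.
have Uf := utility_ae_fin_num Cf; have Ug := utility_ae_fin_num Cg.
apply: filterS3 Uf Ug fin0 => x Uf Ug U0.
have [_ /(_ x) f0 _] := Hf; have [_ /(_ x) g0 _] := Hg.
rewrite !lee_fin in f0 g0.
have := concave_nonneg_midpoint concU f0 g0.
rewrite /F /G /gain -(fineK Uf) -(fineK Ug) -(fineK U0).
case: (U (_ / 2)%:E) => [r| |]//; last by rewrite addye ?leey.
rewrite -!EFinB -!EFinM -!EFinD !lee_fin => h; lra.
Qed.

(** Let [s] be the supremum of the expected gain. The superlevel sets [C n] at
    levels increasing to [s] are decreasing and midpoint convex, so they admit
    a selection converging almost everywhere. Its lower limit is an e-value by
    Fatou's lemma applied under each measure of [H], hence finite [Qa]-almost
    everywhere, so the convergence is to a real number there and upper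
    semicontinuity applies. Uniform integrability then carries [s] over to the
    limit. *)
Lemma utility_gain_maximizer : concave_nonneg U -> usc_nonneg U ->
  exists2 e', improving_evalues H Qa U e0 e' &
    forall e, evalues H e -> \int[Qa]_x gain e x <= \int[Qa]_x gain e' x.
Proof.
move=> concU uscU.
pose V (f : T -> R) := \int[Qa]_x gain (fun x => (f x)%:E) x.
pose real_evalues := [set f : T -> R | evalues H (fun x => (f x)%:E)].
pose s := ereal_sup (V @` real_evalues).
have fe0 : real_evalues (fine \o e0) by exact: fine_evalue.
have Ve0 : V (fine \o e0) = 0.
  rewrite -integral_utility_gain_benchmark.
  exact: integral_utility_gain_fine.
have Vs e : evalues H e -> \int[Qa]_x gain e x <= s.
  move=> He; rewrite -integral_utility_gain_fine//.
  by apply: ereal_sup_ubound; exists (fine \o e) => //; exact: fine_evalue.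
have s0 : 0 <= s by rewrite -integral_utility_gain_benchmark; exact: Vs.
have sfin : s \is a fin_num.
  rewrite ge0_fin_numE//; have [B uiB] := integral_utility_gain_bounded.
  apply: (@le_lt_trans _ _ `|B|%:E); last exact: ltry.
  apply: ge_ereal_sup => _ [f Hf <-].
  have [V0|/ltW V0] := leP 0 (V f); last by apply: le_trans V0 _; rewrite lee_fin.
  apply: (@le_trans _ _ B%:E); last by rewrite lee_fin ler_norm.
  apply: le_trans (uiB _ (conj Hf V0)); rewrite /V integralE.
  by rewrite -[leRHS]sube0 leeB// integral_ge0.
pose level n : \bar R := maxe 0 (s - (n.+1%:R^-1)%:E).
pose C n := [set f | real_evalues f /\ level n <= V f].
have Cimp n f : C n f -> improving_evalues H Qa U e0 (fun x => (f x)%:E).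
  by move=> [Hf]; rewrite /level ge_max => /andP[].
have levelE n : exists c : R, level n = c%:E.
  by exists (fine (level n)); rewrite fineK// /level -(fineK sfin) -EFin_max.
have [] := @midpoint_convex_cvg_selection _ _ _ Qa QaT C.
- move=> n; have n0 : (0 < n.+1%:R^-1 :> R)%R by rewrite invr_gt0.
  have [_ [f Hf <-] sf] := ub_ereal_sup_adherent n0 sfin.
  have [V0|V0] := leP 0 (V f).
    by exists f; split => //; rewrite ge_max V0 ltW.
  (* a near maximizer with negative gain is worse than the benchmark *)
  exists (fine \o e0); split => //; rewrite Ve0 ge_max lexx/=.
  exact/ltW/(lt_trans sf).
- move=> n m nm f [Hf lf]; split => //; apply: le_trans lf.
  have snm : s - (n.+1%:R^-1)%:E <= s - (m.+1%:R^-1)%:E.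
    by rewrite leeD2l// leeN2 lee_fin lef_pV2 ?posrE// ler_nat.
  by rewrite ge_max !le_max lexx snm orbT.
- move=> n f [[/measurable_EFinP mf f0 _] _]; split; first exact: mf.
  by move=> x; have := f0 x; rewrite lee_fin.
- move=> n f g Cf Cg; have [Hf lf] := Cf; have [Hg lg] := Cg.
  split; first exact: midpoint_evalue.
  have [c cE] := levelE n; rewrite cE in lf lg *.
  exact: integral_utility_gain_midpoint (Cimp _ _ Cf) (Cimp _ _ Cg) lf lg.
move=> f_ [Cf_ cf_].
pose e' x := limn_einf (fun k => (f_ k x)%:E).
have Hf_ k : evalues H (fun x => (f_ k x)%:E) by have [] := Cf_ k.
have He' : evalues H e' by exact: limn_einf_evalue.
have Vs' : s <= \int[Qa]_x gain e' x.
  rewrite -(fineK sfin).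
  apply: (@uniformly_integrable_limsup_integral _ _ _ Qa QaT
    (fun k => gain (fun x => (f_ k x)%:E))).
  - by move=> k; exact: measurable_utility_gain.
  - exact: measurable_utility_gain.
  - apply: uniformly_integrable_subset ui => _ [k _ <-].
    exact: imageP (Cimp _ _ (Cf_ k)).
  - move=> eps eps0; near=> k; have [_] := Cf_ k; apply: le_trans.
    rewrite le_max; apply/orP; right; rewrite -(fineK sfin) -EFinB lee_fin.
    rewrite lerB// invf_ple ?posrE//.
    rewrite -natr1 ler_wpDr//.
    by near: k; exact: nbhs_infty_ger.
  have fe' := evalue_ae_fin_num Qa0 He'.
  apply: filterS3 cf_ fe' fin0 => x cx fx U0 a.
  have e'0 : (0 <= fine (e' x))%R by have [_ ? _] := He'; exact: fine_ge0.
  have fl : f_ k x @[k --> \oo] --> fine (e' x).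
    have : (fun k => (f_ k x)%:E) @ \oo --> (fine (e' x))%:E.
      by rewrite fineK// /e' is_cvg_limn_einfE.
    by move/fine_cvg.
  rewrite /gain -(fineK fx) -(fineK U0) lteBlDr// -EFinD.
  move=> /(usc_nonneg_near uscU e'0)/fl.
  apply: (@filterS _ \oo) => k Ufk; rewrite lteBlDr// -EFinD; apply: Ufk.
  by rewrite -lee_fin; have [_ + _] := Hf_ k; exact.
exists e'; first by split => //; exact: le_trans Vs'.
by move=> e He; apply: le_trans Vs'; exact: Vs.
Unshelve. all: by end_near. Qed.

(** The utility difference [D] is the gain of [e'] minus the gain of [e], and
    its negative part is integrable. If its integral were negative, [D], hence
    also the gain of [e], would be integrable, and additivity would make the
    expected gain of [e] exceed that of [e']. *)
Lemma utility_gain_maximizer_optimal e' :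
  (forall e, evalues H e ->
     expectation_diff_wd Qa (U \o e) (U \o e0)) ->
  improving_evalues H Qa U e0 e' ->
  (forall e, evalues H e -> \int[Qa]_x gain e x <= \int[Qa]_x gain e' x) ->
  U_optimal H Qa U e'.
Proof.
move=> wd0 Ce' maxe'; have [He' _] := Ce'; split => // e He.
have ie' := integrable_utility_gain Ce'.
have mge := measurable_utility_gain He.
have mgp := measurable_funepos mge.
(* otherwise the expected gain of [e] would be [+oo], above that of [e'] *)
have gep : \int[Qa]_x (gain e)^\+ x < +oo.
  have [_ []//] := wd0 _ He; rewrite -/(gain e) => gn.
  rewrite ltey; apply/eqP => gp.
  have gn' : \int[Qa]_x (gain e)^\- x \is a fin_num.
    by rewrite ge0_fin_numE// integral_ge0.
  have := maxe' _ He; rewrite integralE gp -(fineK gn') addye//.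
  by rewrite leNgt (integrable_lty measurableT ie').
have iep : Qa.-integrable setT (gain e)^\+.
  by apply/integrableP; split => //; under eq_integral do rewrite gee0_abs//.
have gain_ae : {ae Qa, forall x, [/\ U (e0 x) \is a fin_num,
    U (e' x) \is a fin_num & U (e x) < +oo]}.
  have := integrable_ae measurableT iep.
  apply: filterS3 fin0 (utility_ae_fin_num Ce') => x U0 U' /(_ I) gp.
  split => //; move: U0 => /fineK U0; rewrite ltey; apply/eqP => Ue.
  by move: gp; rewrite funeposE /gain Ue -U0 addye.
pose D x := U (e' x) - U (e x).
have mD : measurable_fun setT D.
  apply: emeasurable_funB; first exact: (measurable_utility mU He').
  exact: (measurable_utility mU He).
have DE : {ae Qa, forall x, D x = gain e' x - gain e x}.
  apply: filterS gain_ae => x [] /fineK U0 /fineK U' Ue.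
  rewrite /D /gain -U0 -U'; case: (U (e x)) Ue => [r| |]//= _.
  by rewrite -!EFinB; congr EFin; ring.
have Dn : \int[Qa]_x D^\- x < +oo.
  apply: (@le_lt_trans _ _
    (\int[Qa]_x ((gain e')^\- x + (gain e)^\+ x))); last first.
    apply: integrable_lty => //; apply: integrableD => //.
    exact: integrable_funeneg.
  apply: ae_le_integral.
  - exact: measurable_funeneg.
  - by apply: emeasurable_funD => //; apply/measurable_funeneg/measurable_utility_gain.
  apply: filterS2 DE gain_ae => x Dx [] /fineK U0 /fineK U' Ue.
  rewrite !funenegE funeposE Dx /gain -U0 -U'.
  case: (U (e x)) Ue => [r| |]// _.
    rewrite -!EFinB -!EFinN -!EFin_max -EFinD lee_fin ge_max; apply/andP; split.
      by rewrite opprD opprK lerD// le_max lexx.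
    by rewrite addr_ge0// le_max lexx orbT.
  by rewrite maxNye adde_ge0// le_max lexx orbT.
split; first by split; [apply: filterS gain_ae => x [_ U' _];
  exact: fin_num_adde_defr|right].
rewrite leNgt; apply/negP => D0.
have Dp : \int[Qa]_x D^\+ x < +oo.
  rewrite ltey; apply/eqP => Dp; move: D0; rewrite integralE Dp.
  have Dn' : \int[Qa]_x D^\- x \is a fin_num.
    by rewrite ge0_fin_numE// integral_ge0.
  by rewrite -(fineK Dn') addye// ltNge leey.
have iD := integrable_funepos_funeneg mD Dp Dn.
have := maxe' _ He.
rewrite (@ae_eq_integral _ _ _ Qa setT (fun x => gain e' x - D x) (gain e))//.
- rewrite integralB// -(fineK (integrable_fin_num measurableT ie')).
  move: D0; rewrite -(fineK (integrable_fin_num measurableT iD)).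
  rewrite -EFinB lee_fin lte_fin => D0; lra.
- by apply: emeasurable_funB => //; exact: measurable_utility_gain.
have := integrable_ae measurableT iD.
apply: filterS2 gain_ae => x [] /fineK U0 /fineK U' Ue /(_ I) Dx _.
move: Dx; rewrite /D /gain -U0 -U'; case: (U (e x)) Ue => [r| |]//= _ _.
by rewrite -!EFinB; congr EFin; ring.
Qed.

End uniformly_integrable_gains.

End optimal_evalue.

(** * Uniform integrability from bounded means *)

Section bounded_mean.
Context {d : measure_display} {T : measurableType d} {R : realType}.
Variables (H : set (probability T R)) (Qa : {measure set T -> \bar R}).
Hypothesis QaT : Qa setT < +oo.
Hypothesis Qa0 : forall A, negligible_for H A -> Qa A = 0.
Variable U : \bar R -> \bar R.
Hypothesis mU : measurable_fun [set z : \bar R | 0 <= z] U.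
Variable e0 : T -> \bar R.
Hypothesis he0 : evalues H e0.

(** With [Y = K + |U e0|], the positive gain of [e] is at most [delta * e + Y].
    Where it is at least [2 * M1], either [delta * e] dominates, and the gain
    is at most [2 * delta * e], or [Y] dominates, and then [Y >= M1] and the
    gain is at most [2 * Y]. The first contribution is small by the choice of
    [delta], uniformly in [e]; the second involves the single integrable
    function [Y]. *)
Lemma uniformly_integrable_of_bounded_mean (E : set (T -> \bar R)) :
  E `<=` evalues H ->
  (forall delta : R, (0 < delta)%R -> exists2 K : R, (0 <= K)%R &
    forall z : R, (0 <= z)%R -> U z%:E <= (K + delta * z)%:E) ->
  Qa.-integrable setT (U \o e0) ->
  ereal_sup [set \int[Qa]_x e x | e in E] < +oo ->
  uniformly_integrable Qa [set (utility_gain U e0 e)^\+ | e in E].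
Proof.
move=> EH Ubound iU0; set S := ereal_sup _ => Soo eps eps0.
have [B B0 SB] : exists2 B : R, (0 <= B)%R & S <= B%:E.
  move: Soo; case: S => [r| |]// _; last by exists 0%R => //; exact: leNye.
  by exists `|r|%R => //; rewrite lee_fin ler_norm.
(* [delta] makes the contribution [2 * delta * B] at most [eps / 2] *)
pose delta := (eps / (4 * (B + 1)))%R.
have delta0 : (0 < delta)%R by rewrite divr_gt0// mulr_gt0// ltr_wpDl.
have deltaB : (2 * delta * B <= eps / 2)%R.
  have -> : (eps / 2 = 2 * delta * (B + 1))%R.
    by rewrite /delta; field; rewrite gt_eqF// ltr_wpDl.
  by apply: ler_wpM2l; [rewrite mulr_ge0// ltW|rewrite lerDl].
clearbody delta; have [K K0 UK] := Ubound _ delta0.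
pose Y x := K%:E + `|U (e0 x)|.
have iY : Qa.-integrable setT Y.
  apply: integrableD => //; first exact: integrable_cst_lty.
  exact: integrable_abse iU0.
have /integrableP[mY _] := iY.
have Y0 x : 0 <= Y x by rewrite adde_ge0.
have eps4 : (0 < eps / 4)%R by rewrite divr_gt0.
have [M1 /(_ Y erefl)] := integrable_uniformly_integrable1 iY eps4.
rewrite integral_tailE; set tY := _ \_ _ => tYe.
have mtY : measurable_fun setT tY by exact: measurable_tail.
have tY0 x : 0 <= tY x by rewrite /tY /patch; case: ifP => /=.
exists (2 * M1)%R => _ [e Ee <-]; have He := EH _ Ee.
have mg := measurable_funepos (measurable_utility_gain mU he0 He).
have [me e_ge0 _] := He.
rewrite integral_tailE.
apply: (@le_trans _ _
    (\int[Qa]_x ((2 * delta)%:E * e x + 2%:E * tY x))); last first.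
  rewrite ge0_integralD//; last 4 first.
  - by move=> x _; rewrite mule_ge0// lee_fin mulr_ge0// ltW.
  - exact: measurable_funeM.
  - by move=> x _; rewrite mule_ge0.
  - exact: measurable_funeM.
  have d20 : (0 <= 2 * delta)%R by rewrite mulr_ge0// ltW.
  rewrite !ge0_integralZl_EFin//.
  have eB : \int[Qa]_x e x <= B%:E.
    by apply: le_trans SB; apply: ereal_sup_ubound; exists e.
  have two0 : 0 <= 2%:E :> \bar R by rewrite lee_fin.
  apply: (@le_trans _ _ ((2 * delta)%:E * B%:E + 2%:E * (eps / 4)%:E)).
    by apply: leeD; apply: lee_wpmul2l => //; rewrite lee_fin.
  by rewrite -!EFinM -EFinD lee_fin; lra.
apply: ae_le_integral.
- exact: measurable_tail.
- by apply: emeasurable_funD; exact: measurable_funeM.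
have efin := evalue_ae_fin_num Qa0 He.
apply: filterS2 efin (integrable_ae measurableT iU0) => x ex /(_ I) /= U0.
have e2 : 0 <= (2 * delta)%:E * e x by rewrite mule_ge0// lee_fin mulr_ge0// ltW.
rewrite {1}/patch; case: ifPn => [|_]; last by rewrite adde_ge0// mule_ge0.
rewrite inE/= !funeposE => Mf.
have tYE : tY x = if (M1%:E <= Y x) then Y x else 0.
  rewrite /tY /patch /= gee0_abs//; case: ifPn => [|].
    by rewrite inE/= gee0_abs// => ->.
  by rewrite notin_setE/= gee0_abs// => /negP/negbTE ->.
have := UK _ (fine_ge0 (e_ge0 x)); rewrite fineK//.
move: Mf; rewrite gee0_abs ?le_max ?lexx ?orbT// tYE /Y /utility_gain.
rewrite -(fineK ex) -(fineK U0).
have z0 := fine_ge0 (e_ge0 x).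
move: (fine (e x)) z0 => z z0; move: (fine (U (e0 x))) => r.
have rr : (- r <= `|r|)%R by rewrite -normrN ler_norm.
have r0 : (0 <= `|r|)%R by [].
have dz : (0 <= delta * z)%R by rewrite mulr_ge0// ltW.
rewrite (_ : K%:E + `|r%:E| = (K + `|r|)%:E)// lee_fin.
rewrite -(fun_if EFin) -!EFinM -!EFinD.
have out : (0 <= 2 * delta * z + 2 * (if M1 <= K + `|r| then K + `|r| else 0))%R.
  by rewrite -mulrA; case: ifP => _; lra.
case: (U z%:E) => [v| |]//; last first.
  by rewrite maxNye lee_fin.
rewrite -EFinB -EFin_max.
rewrite !lee_fin => Mv vK.
rewrite ge_max out andbT.
move: out; rewrite -![(2 * delta * z)%R]mulrA.
set w := (delta * z)%R in dz vK *.
case: (lerP M1) => [_|YM1] out; first by lra.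
move: Mv => /orP[Mv|M10]; first by lra.
lra.
Qed.

End bounded_mean.

(** * Existence of optimal e-values *)

Theorem theorem4 (d : measure_display) (T : measurableType d) (R : realType)
    (H : set (probability T R)) (Q : probability T R)
    (Qa Qs : {measure set T -> \bar R})
    (hQ : generalized_lebesgue_decomposition H Q Qa Qs)
    (U : \bar R -> \bar R)
    (mU : measurable_fun [set z : \bar R | 0 <= z] U)
    (concU : concave_nonneg U) (uscU : usc_nonneg U)
    (e0 : T -> \bar R) (he0 : evalues H e0)
    (fin0 : {ae Qa, forall x, U (e0 x) \is a fin_num})
    (wd0 : forall e, evalues H e ->
       expectation_diff_wd Qa (U \o e) (U \o e0)) :
  (uniformly_integrable Qa
     [set (fun x => U (e x) - U (e0 x))^\+ |
        e in improving_evalues H Qa U e0] ->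
   exists e', U_optimal H Qa U e') /\
  ((forall z : R, (0 < z)%R -> U z%:E \is a fin_num) ->
   limf_esup (fun z : R => U z%:E * (z^-1)%:E) +oo%R <= 0 ->
   Qa.-integrable setT (U \o e0) ->
   ereal_sup [set \int[Qa]_x e x | e in improving_evalues H Qa U e0] < +oo ->
   uniformly_integrable Qa
     [set (fun x => U (e x) - U (e0 x))^\+ |
        e in improving_evalues H Qa U e0]).
Proof.
have [Qsum _ Qa0] := hQ.
have QaT : Qa setT < +oo.
  apply: (@le_lt_trans _ _ (Q setT)); first by rewrite Qsum// leeDl.
  by rewrite probability_setT ltry.
split.
- move=> ui.
  have [e' Ce' maxe'] :=
    utility_gain_maximizer QaT Qa0 mU he0 fin0 ui concU uscU.
  by exists e'; exact: (utility_gain_maximizer_optimal QaT mU he0 fin0 ui).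
move=> Ufin limU iU0 supC.
apply: (uniformly_integrable_of_bounded_mean QaT Qa0 mU he0 _ _ iU0 supC).
- by move=> e [].
- exact: concave_nonneg_affine_bound.
Qed.
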